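(* Let $\mathbf{k}$ be a commutative ring, let $k\in\mathbb{N}$, let $n\geq k$ be an integer, and let $a_1,a_2,\ldots,a_k\in\mathbf{k}$. Let $\mathcal{S}$ be the ring of symmetric polynomials in $\mathbf{k}[x_1,\ldots,x_k]$, and let $I$ be the ideal of $\mathcal{S}$ generated by $h_{n-k+1}-a_1,\ h_{n-k+2}-a_2,\ \ldots,\ h_n-a_k$. For any $\alpha,\beta,\gamma\in P_{k,n}$, set $g_{\alpha,\beta,\gamma}=\operatorname{coeff}_{\gamma^\vee}\left(\overline{s_\alpha}\,\overline{s_\beta}\right)\in\mathbf{k}$. Then, for any $\alpha,\beta,\gamma\in P_{k,n}$, \[ g_{\alpha,\beta,\gamma}=g_{\alpha,\gamma,\beta}=g_{\beta,\alpha,\gamma}=g_{\beta,\gamma,\alpha}=g_{\gamma,\alpha,\beta}=g_{\gamma,\beta,\alpha}=\operatorname{coeff}_{\omega}\left(\overline{s_\alpha s_\beta s_\gamma}\right). \]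
   Context: $h_m$ is the $m$-th complete homogeneous symmetric polynomial in $x_1,\ldots,x_k$, and $s_\lambda=s_\lambda(x_1,\ldots,x_k)$ is the Schur polynomial. $P_{k,n}$ is the set of all partitions with at most $k$ parts, all of which are $\leq n-k$. $\overline{m}$ denotes the residue class of $m\in\mathcal{S}$ in $\mathcal{S}/I$. The family $(\overline{s_\lambda})_{\lambda\in P_{k,n}}$ is a basis of the $\mathbf{k}$-module $\mathcal{S}/I$; for $\mu\in P_{k,n}$, $\operatorname{coeff}_\mu:\mathcal{S}/I\to\mathbf{k}$ is the $\mathbf{k}$-linear map sending $\overline{s_\mu}$ to $1$ and every other $\overline{s_\lambda}$ ($\lambda\in P_{k,n}$) to $0$. $\omega=(n-k,n-k,\ldots,n-k)$ ($k$ entries). For $\nu=(\nu_1,\ldots,\nu_k)\in P_{k,n}$, the complement is $\nu^\vee=(n-k-\nu_k,n-k-\nu_{k-1},\ldots,n-k-\nu_1)\in P_{k,n}$. *)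

(* Defs.v *)
From HB Require Import structures.
From Stdlib Require Import ClassicalEpsilon.
From mathcomp Require Import all_boot all_order all_algebra.
From mathcomp Require Import boolp.
From mathcomp Require Import mpoly.

Set Implicit Arguments.
Unset Strict Implicit.
Unset Printing Implicit Defensive.

Import GRing.Theory.

Local Open Scope ring_scope.
Local Open Scope quotient_scope.

Record sympoly (R : comNzRingType) (k : nat) := Sympoly {
  sympoly_val :> {mpoly R[k]};
  sympoly_valP : sympoly_val \is symmetric
}.

Section SympolyAlgebra.
Variables (R : comNzRingType) (k : nat).

HB.instance Definition _ := [isSub for @sympoly_val R k].
HB.instance Definition _ := [Choice of sympoly R k by <:].
HB.instance Definition _ := [SubChoice_isSubComNzRing of sympoly R k by <:].
HB.instance Definition _ := [SubZmodule_isSubLmodule of sympoly R k by <:].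
HB.instance Definition _ :=
  [SubNzRing_SubLmodule_isSubLalgebra of sympoly R k by <:].
HB.instance Definition _ := [SubLalgebra_isSubAlgebra of sympoly R k by <:].

End SympolyAlgebra.

Section CompleteHomogeneous.
Variables (R : comNzRingType) (k : nat).

Definition mcompl (m : nat) : {mpoly R[k]} :=
  \sum_(t : 'X_{1..k < m.+1} | mdeg t == m) 'X_[t].

Lemma mcoeff_mcompl m (t : 'X_{1..k}) : (mcompl m)@_t = (mdeg t == m)%:R.
Proof.
rewrite /mcompl raddf_sum /=.
under eq_bigr do rewrite mcoeffX.
have [tm|tm] := eqVneq (mdeg t) m.
  have lt_t : (mdeg t < m.+1)%N by rewrite tm.
  rewrite (bigD1 (BMultinom lt_t)) /= ?tm // eqxx big1 ?addr0 // => u.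
  by case/andP=> _; rewrite -val_eqE /= => /negPf ->.
rewrite big1 // => u /eqP um; case: eqP => // ut.
by rewrite -um ut eqxx in tm.
Qed.

Lemma mcompl_sym m : mcompl m \is symmetric.
Proof.
apply/issymP => s; apply/mpolyP => t.
by rewrite mcoeff_sym !mcoeff_mcompl mdeg_mperm.
Qed.

Definition hsym (m : nat) : sympoly R k := Sympoly (mcompl_sym m).

End CompleteHomogeneous.

Arguments hsym : clear implicits.

Section Schur.
Variables (R : comNzRingType) (k : nat).

Definition alternant (e : 'I_k -> nat) : {mpoly R[k]} :=
  \det (\matrix_(i < k, j < k) 'X_i ^+ e j).

(* rho = (k-1, k-2, ..., 0). *)
Definition rho (j : 'I_k) : nat := (k - j.+1)%N.

(* Bialternant definition s_la = a_(la+rho) / a_rho.  The quotient exists and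
   is unique over every commutative ring, since a_rho (the Vandermonde product)
   is not a zero divisor; [epsilon] only names it. *)
Definition schur (la : 'I_k -> nat) : sympoly R k :=
  epsilon (inhabits 0) (fun s : sympoly R k =>
    sympoly_val s * alternant rho = alternant (fun j => la j + rho j)%N).

End Schur.

Section BoxPartitions.
Variables (k n : nat).

(* P_(k,n); a partition is padded with zeros to exactly k entries. *)
Record boxpart := Boxpart {
  boxpart_val :> {ffun 'I_k -> 'I_(n - k).+1};
  boxpart_valP :
    [forall i : 'I_k, forall j : 'I_k,
      (i <= j)%N ==> (boxpart_val j <= boxpart_val i)%N]
}.

HB.instance Definition _ := [isSub for boxpart_val].
HB.instance Definition _ := [Finite of boxpart by <:].

Definition parts (la : boxpart) : 'I_k -> nat := fun i => la i.

Lemma boxpart_nonincr (la : boxpart) (i j : 'I_k) :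
  (i <= j)%N -> (la j <= la i)%N.
Proof.
exact: (implyP (forallP (forallP (boxpart_valP la) i) j)).
Qed.

Lemma boxpart_compl_subproof (la : boxpart) :
  let f := [ffun i : 'I_k => rev_ord (la (rev_ord i))] in
  [forall i : 'I_k, forall j : 'I_k, (i <= j)%N ==> (f j <= f i)%N].
Proof.
apply/'forall_forallP => i j; apply/implyP => le_ij; rewrite !ffunE /=.
by rewrite leq_sub2l // ltnS boxpart_nonincr //= leq_sub2l.
Qed.

(* On 'I_(n - k).+1, rev_ord is x |-> n - k - x. *)
Definition boxpart_compl (la : boxpart) : boxpart :=
  Boxpart (boxpart_compl_subproof la).

Lemma boxpart_omega_subproof :
  let f := [ffun=> ord_max] : {ffun 'I_k -> 'I_(n - k).+1} in
  [forall i : 'I_k, forall j : 'I_k, (i <= j)%N ==> (f j <= f i)%N].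
Proof. by apply/'forall_forallP => i j; rewrite !ffunE leqnn implybT. Qed.

Definition boxpart_omega : boxpart := Boxpart boxpart_omega_subproof.

End BoxPartitions.

Arguments boxpart_omega : clear implicits.

Section QuotientRing.
Variables (R : comNzRingType) (k n : nat) (a : 'I_k -> R).

(* The index i : 'I_k starts at 0, so a i stands for a_(i+1). *)
Definition idealI_gen (i : 'I_k) : sympoly R k :=
  hsym R k (n - k + i.+1) - (a i)%:A.

Definition idealI : pred (sympoly R k) := fun p =>
  `[< exists q : 'I_k -> sympoly R k, p = \sum_(i < k) q i * idealI_gen i >].

Lemma idealIP p :
  reflect (exists q : 'I_k -> sympoly R k, p = \sum_(i < k) q i * idealI_gen i)
          (p \in idealI).
Proof. exact: asboolP. Qed.

Lemma idealI_zmod : zmod_closed idealI.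
Proof.
split=> [|p q /idealIP[u ->] /idealIP[v ->]]; apply/idealIP.
  by exists (fun=> 0); rewrite big1 // => i _; rewrite mul0r.
exists (fun i => u i - v i); rewrite -sumrB.
by apply: eq_bigr => i _; rewrite mulrBl.
Qed.

HB.instance Definition _ :=
  GRing.isZmodClosed.Build (sympoly R k) idealI idealI_zmod.

Definition idealI_closed : zmodClosed (sympoly R k) :=
  GRing.ZmodClosed.clone (sympoly R k) idealI _.

Lemma idealI_mull p q : q \in idealI -> p * q \in idealI.
Proof.
move=> /idealIP[u ->]; apply/idealIP; exists (fun i => p * u i).
by rewrite mulr_sumr; apply: eq_bigr => i _; rewrite mulrA.
Qed.

(* The library's {ideal_quot _} asks for a proof that the ideal is proper, which
   is a consequence of the basis theorem here; hence the ring structure is put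
   directly on the additive quotient, as a possibly trivial ring. *)
Definition symquot := {ideal_quot idealI_closed}.

HB.instance Definition _ := GRing.Zmodule.on symquot.
HB.instance Definition _ := EqQuotient.on symquot.

Definition symproj (p : sympoly R k) : symquot := \pi_symquot p.

Lemma symproj_eq p q : (symproj p == symproj q) = (p - q \in idealI).
Proof. by rewrite Quotient.idealrBE. Qed.

Lemma reprK_symquot (x : symquot) : symproj (repr x) = x.
Proof. exact: reprK. Qed.

Lemma symprojB p q : symproj (p - q) = symproj p - symproj q.
Proof. exact: (raddfB (\pi_{ideal_quot idealI_closed})). Qed.

Lemma symprojD p q : symproj (p + q) = symproj p + symproj q.
Proof. exact: (raddfD (\pi_{ideal_quot idealI_closed})). Qed.

Definition symquot_one : symquot := symproj 1.
Definition symquot_mul (x y : symquot) : symquot := symproj (repr x * repr y).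
Definition symquot_scale (c : R) (x : symquot) : symquot :=
  symproj (c *: repr x).

Lemma symproj_mul p q : symquot_mul (symproj p) (symproj q) = symproj (p * q).
Proof.
have rP r : repr (symproj r) - r \in idealI.
  by rewrite -symproj_eq reprK_symquot.
apply/eqP; rewrite symproj_eq.
set p' := repr _; set q' := repr _.
have -> : p' * q' - p * q = p' * (q' - q) + q * (p' - p).
  by rewrite !mulrBr addrA -(mulrC p') subrK (mulrC q).
apply: rpredD; apply: idealI_mull; exact: rP.
Qed.

Lemma symproj_scale c p : symquot_scale c (symproj p) = symproj (c *: p).
Proof.
apply/eqP; rewrite symproj_eq -scalerBr -mulr_algl idealI_mull //.
by rewrite -symproj_eq reprK_symquot.
Qed.

Lemma symquot_mulA : associative symquot_mul.
Proof.
move=> x y z; rewrite -(reprK_symquot x) -(reprK_symquot y) -(reprK_symquot z).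
by rewrite !symproj_mul mulrA.
Qed.

Lemma symquot_mulC : commutative symquot_mul.
Proof. by move=> x y; rewrite /symquot_mul mulrC. Qed.

Lemma symquot_mul1 : left_id symquot_one symquot_mul.
Proof. by move=> x; rewrite -(reprK_symquot x) symproj_mul mul1r. Qed.

Lemma symquot_mulDl : left_distributive symquot_mul +%R.
Proof.
move=> x y z; rewrite -(reprK_symquot x) -(reprK_symquot y) -(reprK_symquot z).
by rewrite -symprojD !symproj_mul -symprojD mulrDl.
Qed.

HB.instance Definition _ := GRing.Zmodule_isComPzRing.Build symquot
  symquot_mulA symquot_mulC symquot_mul1 symquot_mulDl.

Lemma symquot_scaleA c d x :
  symquot_scale c (symquot_scale d x) = symquot_scale (c * d) x.
Proof. by rewrite -(reprK_symquot x) !symproj_scale scalerA. Qed.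

Lemma symquot_scale1 : left_id 1 symquot_scale.
Proof. by move=> x; rewrite -(reprK_symquot x) symproj_scale scale1r. Qed.

Lemma symquot_scaleDr : right_distributive symquot_scale +%R.
Proof.
move=> c x y; rewrite -(reprK_symquot x) -(reprK_symquot y).
by rewrite -symprojD !symproj_scale -symprojD scalerDr.
Qed.

Lemma symquot_scaleDl x : {morph symquot_scale^~ x : c d / c + d}.
Proof.
move=> c d; rewrite -(reprK_symquot x).
by rewrite !symproj_scale -symprojD scalerDl.
Qed.

HB.instance Definition _ := GRing.Zmodule_isLmodule.Build R symquot
  symquot_scaleA symquot_scale1 symquot_scaleDr symquot_scaleDl.

Lemma symquot_scaleAl (c : R) (x y : symquot) : c *: (x * y) = (c *: x) * y.
Proof.
rewrite -(reprK_symquot x) -(reprK_symquot y).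
have mulE p q : symproj p * symproj q = symproj (p * q) := symproj_mul p q.
have scaleE p : c *: symproj p = symproj (c *: p) := symproj_scale c p.
by rewrite mulE !scaleE mulE scalerAl.
Qed.

Lemma symproj_is_zmod_morphism : zmod_morphism symproj.
Proof. exact: symprojB. Qed.

HB.instance Definition _ :=
  GRing.isZmodMorphism.Build (sympoly R k) symquot symproj
    symproj_is_zmod_morphism.

Lemma symproj_is_monoid_morphism : monoid_morphism symproj.
Proof. by split=> // p q; rewrite [RHS]symproj_mul. Qed.

HB.instance Definition _ :=
  GRing.isMonoidMorphism.Build (sympoly R k) symquot symproj
    symproj_is_monoid_morphism.

Lemma symproj_is_scalable : scalable symproj.
Proof. by move=> c p; rewrite [RHS]symproj_scale. Qed.

HB.instance Definition _ :=
  GRing.isScalable.Build R (sympoly R k) symquot *:%R symproj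
    symproj_is_scalable.

Definition schurbar (la : boxpart k n) : symquot := symproj (schur R (parts la)).

(* The linear map is named by [epsilon]; it exists and is unique because the
   schurbar la form a basis of symquot when k <= n. *)
Definition coeff (mu : boxpart k n) : {linear symquot -> R^o} :=
  epsilon (inhabits (\0 : {linear symquot -> R^o}))
    (fun f : {linear symquot -> R^o} =>
       forall la : boxpart k n, f (schurbar la) = (la == mu)%:R).

Definition gcoeff (al be ga : boxpart k n) : R :=
  coeff (boxpart_compl ga) (schurbar al * schurbar be).

End QuotientRing.

(* Main.v *)
(* Write a_e for the alternant with exponents e, and put
   F_j = x_j^n - \sum_m a_m [t^m] \prod_(l != j) (t - x_l) in k[x_1, ..., x_k].
   The F_j are combinations of the generators of I, with a matrix of determinant a_rho, so a_rho I
   lies in the ideal generated by the F_j.  Expanding the residue of q / \prod_j F_j at infinity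
   gives a linear form res that kills this ideal, whence p |-> res (p a_rho) kills I.
   For lambda and mu in the box, counting exponents in the expansion for s_lambda s_mu a_rho leaves
   only the undeformed term, the coefficient of x^(omega + rho), which is the Kronecker delta of
   lambda and mu^vee.  The s_lambda span S/I, because x_j^n can be replaced by the lower terms
   \sum_m a_m [t^m] \prod_(l != j) (t - x_l) in an alternant.  Hence coeff_(gamma^vee) maps x to
   res (x s_gamma a_rho), and g_(alpha, beta, gamma) = res (s_alpha s_beta s_gamma a_rho) is
   symmetric. *)
Require Import Defs.
From HB Require Import structures.
From Stdlib Require Import ClassicalEpsilon.
From mathcomp Require Import all_fingroup all_boot all_order all_algebra.
From mathcomp Require Import zify ring.
From mathcomp Require Import mpoly.

Set Implicit Arguments.
Unset Strict Implicit.
Unset Printing Implicit Defensive.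

Import GRing.Theory.

Local Open Scope ring_scope.

(** * Complete homogeneous polynomials in a subset of the variables *)

Section SymmetricFunctions.
Variables (R : comNzRingType) (k : nat).
Implicit Types (p q : {mpoly R[k]}) (t u m : 'X_{1..k}) (A : {set 'I_k}).

Lemma mcoeffMXE p m t :
  (p * 'X_[m])@_t = if (m <= t)%MM then p@_(t - m)%MM else 0.
Proof.
case: ifP => [le_mt|/negP le_mt]; first by rewrite -{1}(submK le_mt) addmC mcoeffMX.
apply: memN_msupp_eq0; rewrite (perm_mem (msuppMX p m)).
by apply/mapP => -[u _ tu]; apply: le_mt; rewrite tu lem_addr.
Qed.

Definition hcompl A d : {mpoly R[k]} :=
  \sum_(t : 'X_{1..k < d.+1} | (mdeg t == d) && [forall i, (i \notin A) ==> (t i == 0%N)])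
    'X_[t].

Lemma mcoeff_hcompl A d t :
  (hcompl A d)@_t = ((mdeg t == d) && [forall i, (i \notin A) ==> (t i == 0%N)])%:R.
Proof.
rewrite /hcompl raddf_sum /=; under eq_bigr do rewrite mcoeffX.
case: (boolP (_ && _)) => [/andP[/eqP td tA]|/negPf tN].
  have lt_t : (mdeg t < d.+1)%N by rewrite td.
  rewrite (bigD1 (BMultinom lt_t)) /= ?td ?eqxx // big1 ?addr0 // => u.
  by case/andP=> _; rewrite -val_eqE /= => /negPf ->.
rewrite big1 // => u uP; case: eqP => // ut.
by rewrite ut tN in uP.
Qed.

Lemma hcomplT d : hcompl setT d = mcompl R k d.
Proof.
apply/mpolyP => t; rewrite mcoeff_hcompl mcoeff_mcompl.
by rewrite (_ : [forall i, _] = true) ?andbT //; apply/forallP => i; rewrite inE.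
Qed.

(** The monomials of h_(d+1) divisible by x_i are exactly x_i times the monomials of h_d. *)
Lemma hcompl_recD1 A d i : i \in A ->
  hcompl A d.+1 - 'X_i * hcompl A d = hcompl (A :\ i) d.+1.
Proof.
move=> iA; apply/eqP; rewrite subr_eq; apply/eqP/mpolyP => t.
rewrite mcoeffD mulrC mcoeffMXE lep1mP !mcoeff_hcompl.
have [ti|ti] := eqVneq (t i) 0%N.
  rewrite addr0; congr (_ && _)%:R; apply/'forall_implyP/'forall_implyP => tA j.
    by rewrite !inE negb_and negbK => /orP[/eqP ->|/tA //]; rewrite ti.
  by move=> jA; apply: tA; rewrite !inE negb_and jA orbT.
have -> : [forall j, (j \notin A :\ i) ==> (t j == 0%N)] = false.
  by apply/negbTE/forallPn; exists i; rewrite !inE eqxx /= ti.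
have le_it : (U_(i) <= t)%MM by rewrite lep1mP.
rewrite andbF add0r -{1}(submK le_it) mdegD mdeg1 addn1 eqSS; congr (_ && _)%:R.
apply: eq_forallb => j; have [jA|jA] := boolP (j \in A) => //=.
rewrite mnmBE mnm1E (_ : (i == j) = false) ?subn0 //.
by apply: contraNF jA => /eqP <-.
Qed.

Lemma hcompl0 A : hcompl A 0 = 1.
Proof.
apply/mpolyP => t; rewrite mcoeff_hcompl mcoeff1 mdeg_eq0; have [->|//] := eqVneq.
by rewrite (_ : [forall i, _] = true) //; apply/forallP => i; rewrite mnm0E eqxx implybT.
Qed.

Lemma hcompl1 i d : hcompl [set i] d = 'X_i ^+ d.
Proof.
apply/mpolyP => t; rewrite mcoeff_hcompl mcoeffXn; congr (_%:R); congr nat_of_bool.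
apply/andP/eqP => [[/eqP <- /'forall_implyP tA]|<-].
  apply/mnmP => j; rewrite mulmnE mnm1E.
  have [<-|ij] := eqVneq i j; last by rewrite (eqP (tA j _)) // inE eq_sym.
  rewrite mul1n mdegE (bigD1 i) //= big1 ?addn0 // => l li.
  by apply/eqP/tA; rewrite inE.
rewrite mdegMn mdeg1 mul1n eqxx; split=> //; apply/'forall_implyP => j.
by rewrite inE mulmnE mnm1E eq_sym => /negPf ->; rewrite mul0n.
Qed.

(* The sequence h_0, h_1, ... preceded by [c] zeros. *)
Definition hshift c A N : {mpoly R[k]} := if (c <= N)%N then hcompl A (N - c) else 0.

Lemma hshift_recD1 c A N i : i \in A ->
  hshift c A N.+1 - 'X_i * hshift c A N = hshift c (A :\ i) N.+1.
Proof.
(* The recurrence survives at the boundary c = N + 1 because h_0 = 1 for every set of variables. *)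
rewrite /hshift => iA; have [le_cN|lt_Nc|->] := ltngtP c N.+1.
- by rewrite -ltnS le_cN subSn // hcompl_recD1.
- by rewrite leqNgt ltnW //= mulr0 subr0.
- by rewrite ltnn subnn !hcompl0 mulr0 subr0.
Qed.

End SymmetricFunctions.

(** * Polynomials in the shift operator *)

Section Shift.
Variable (A : comNzRingType).
Implicit Types (Q : {poly A}) (u : nat -> A).

(* The action of a polynomial in the shift operator on sequences. *)
Definition shift_app Q u N : A := \sum_(m < size Q) Q`_m * u (N + m)%N.

Lemma shift_appE b Q u N : (size Q <= b)%N ->
  shift_app Q u N = \sum_(m < b) Q`_m * u (N + m)%N.
Proof.
move=> le_b; rewrite /shift_app.
rewrite (big_ord_widen b (fun m => Q`_m * u (N + m)%N)) // big_mkcond.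
by apply: eq_bigr => m _; case: ltnP => // ?; rewrite nth_default ?mul0r.
Qed.

Lemma shift_appM c Q u N :
  shift_app (('X - c%:P) * Q) u N = shift_app Q (fun N => u N.+1 - c * u N) N.
Proof.
have sz : (size (('X - c%:P) * Q)%R <= (size Q).+1)%N.
  by apply: (leq_trans (size_polyMleq _ _)); rewrite size_XsubC.
rewrite (shift_appE _ _ sz); under eq_bigr => m _.
  rewrite mulrBl coefB coefXM coefCM mulrBl; over.
rewrite sumrB big_ord_recl /= mul0r add0r [X in _ - X]big_ord_recr /=.
rewrite nth_default // mulr0 mul0r addr0 -sumrB.
by apply: eq_bigr => m _; rewrite /bump /= add1n addnS mulrBr [c * _]mulrC mulrA.
Qed.

Lemma eq_shift_app Q u v : u =1 v -> shift_app Q u =1 shift_app Q v.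
Proof. by move=> uv N; apply: eq_bigr => m _; rewrite uv. Qed.

Lemma shift_app1 u N : shift_app 1 u N = u N.
Proof. by rewrite /shift_app size_poly1 big_ord1 coef1 addn0 mul1r. Qed.

End Shift.

(** * The products of the t - x_i, and powers of one variable *)

Section VariablePolynomials.
Variables (R : comNzRingType) (k : nat).

Local Notation XsubV i := ('X - ('X_i : {mpoly R[k]})%:P).

(** By [hshift_recD1], each factor t - x_i removes the variable x_i and advances the index by
    one. *)
Lemma shift_app_hshift c (r : seq 'I_k) (A : {set 'I_k}) N : uniq r -> {subset r <= A} ->
  shift_app (\prod_(i <- r) XsubV i) (hshift R c A) N =
  hshift R c (A :\: [set i in r]) (N + size r).
Proof.
elim: r A N => [|i r IHr] A N; first by rewrite big_nil shift_app1 addn0 set_nil setD0.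
move=> /= /andP[ir ur] rA; have iA : i \in A by rewrite rA ?mem_head.
rewrite big_cons shift_appM.
rewrite (@eq_shift_app _ _ _ (fun N => hshift R c (A :\ i) N.+1)); last first.
  by move=> N'; rewrite hshift_recD1.
transitivity (shift_app (\prod_(i <- r) XsubV i) (hshift R c (A :\ i)) N.+1).
  by apply: eq_bigr => m _; rewrite addSn.
rewrite IHr // ?addSnnS ?set_cons -?setDDl // => j jr.
rewrite !inE rA ?in_cons ?jr ?orbT // andbT.
by apply: contraNneq ir => <-.
Qed.

Definition vpoly : {poly {mpoly R[k]}} := \prod_(i < k) XsubV i.

Definition vpolyD1 (j : 'I_k) : {poly {mpoly R[k]}} := \prod_(i < k | i != j) XsubV i.

(** This is h_(N-k+1), read as 0 for negative index; the offset k - 1 is the degree of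
    [vpolyD1 j]. *)
Definition hs N : {mpoly R[k]} := hshift R k.-1 setT N.

Lemma size_vpolyD1 j : size (vpolyD1 j) = k.
Proof.
rewrite /vpolyD1 -big_filter size_prod_XsubC size_filter.
rewrite -[X in _ = X](card_ord k) (cardD1 j) inE add1n; congr _.+1.
by rewrite cardE size_filter; apply: eq_count => i; rewrite !inE andbT.
Qed.

(** Applying [vpolyD1 j] to the sequence [hs] removes all variables except x_j, and h_N(x_j) =
    x_j^N. *)
Lemma exp_var_vpolyD1 j N : 'X_j ^+ N = \sum_(m < k) (vpolyD1 j)`_m * hs (N + m).
Proof.
pose r := [seq i <- index_enum 'I_k | i != j].
have ur : uniq r by rewrite filter_uniq // index_enum_uniq.
have szr : size r = k.-1.
  by have := size_vpolyD1 j; rewrite /vpolyD1 -big_filter size_prod_XsubC => /(congr1 predn).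
transitivity (hshift R k.-1 [set j] (N + k.-1)%N).
  by rewrite /hshift leq_addl addnK hcompl1.
rewrite -(@shift_appE _ k) ?size_vpolyD1 // /vpolyD1 -big_filter -/r.
rewrite shift_app_hshift //; last by move=> i; rewrite inE.
have -> : [set j] = setT :\: [set i in r].
  by apply/setP => i; rewrite !inE mem_filter mem_index_enum !andbT negbK.
by rewrite szr.
Qed.

Lemma vpolyE j : vpoly = XsubV j * vpolyD1 j.
Proof. by rewrite /vpoly (bigD1 j). Qed.

(** Synthetic division of [vpoly] by t - x_j, iterated until the coefficients vanish. It separates
    the powers of x_j from symmetric factors. *)
Lemma coef_vpolyD1 j m :
  (vpolyD1 j)`_m = \sum_(s < k) 'X_j ^+ s * vpoly`_(m + s.+1).
Proof.
have rec m' : (vpolyD1 j)`_m' = vpoly`_m'.+1 + 'X_j * (vpolyD1 j)`_m'.+1.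
  by rewrite (vpolyE j) mulrBl coefB coefXM coefCM /= subrK.
suff /(_ k) -> b : (vpolyD1 j)`_m = \sum_(s < b) 'X_j ^+ s * vpoly`_(m + s.+1)
                     + 'X_j ^+ b * (vpolyD1 j)`_(m + b).
  by rewrite nth_default ?mulr0 ?addr0 // size_vpolyD1 leq_addl.
elim: b => [|b IHb]; first by rewrite big_ord0 add0r expr0 mul1r addn0.
by rewrite IHb big_ord_recr /= rec mulrDr addrA mulrA -exprSr addnS.
Qed.

Lemma vpoly_coef_sym m : vpoly`_m \is symmetric.
Proof.
apply/issymP => s; rewrite -(coef_map (msym s)); congr ((polyseq _)`_m).
rewrite /vpoly rmorph_prod /= [RHS](reindex_inj (@perm_inj _ s)) /=.
apply: eq_bigr => i _; rewrite rmorphB /= map_polyX map_polyC /=.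
by rewrite /msym mmapX mmap1U.
Qed.

Lemma hs_sym N : hs N \is symmetric.
Proof.
rewrite /hs /hshift; case: ifP => _; last exact: rpred0.
by rewrite hcomplT mcompl_sym.
Qed.

(** Up to sign, the coefficients are the elementary symmetric polynomials in the variables listed in
    [r]. *)
Lemma msupp_coef_prod_XsubV (r : seq 'I_k) m t : uniq r ->
  t \in msupp (\prod_(i <- r) XsubV i)`_m ->
  (mdeg t + m = size r)%N /\ forall i, (t i <= (i \in r))%N.
Proof.
elim: r m t => [|i r IHr] m t /=.
  rewrite big_nil coef1 => _; case: m => [|m]; last by rewrite msupp0.
  rewrite msupp1 inE => /eqP ->; rewrite mdeg0; split=> // i.
  by rewrite mnm0E.
case/andP=> ir ur; rewrite big_cons mulrBl coefB coefXM coefCM mulrC.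
move/msuppB_le; rewrite mem_cat => /orP[].
  case: m => [|m]; first by rewrite msupp0.
  move=> /(IHr _ _ ur)[<- tr]; split=> [|l]; first by rewrite addnS.
  by rewrite (leq_trans (tr l)) // in_cons; case: (_ == _) => //=; case: (_ \in _).
rewrite (perm_mem (msuppMX _ _)) => /mapP[u /(IHr _ _ ur)[<- ur'] ->].
rewrite mdegD mdeg1; split=> [|l]; first by rewrite -addnA add1n.
rewrite mnmDE mnm1E in_cons [l == i]eq_sym; case: eqP => [<-|_] //=; last by rewrite add0n.
by have := ur' i; rewrite (negPf ir) leqn0 => /eqP ->.
Qed.

Lemma msupp_coef_vpolyD1 j m t : t \in msupp (vpolyD1 j)`_m ->
  [/\ (mdeg t + m < k)%N, t j = 0%N & forall i, (t i <= 1)%N].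
Proof.
have := size_vpolyD1 j; rewrite /vpolyD1 -big_filter size_prod_XsubC => szr.
move/(@msupp_coef_prod_XsubV _ _ _ (filter_uniq _ (index_enum_uniq _))) => [tm tr].
split=> [||i]; first by rewrite tm; apply: eq_leq.
  by have := tr j; rewrite mem_filter eqxx leqn0 => /eqP.
by apply: (leq_trans (tr i)); case: (_ \in _).
Qed.
End VariablePolynomials.

(** * Jacobi-Trudi determinants and cancellation of a_rho *)

Lemma exists_argmax (T : eqType) (r : seq T) (f : T -> nat) x0 : x0 \in r ->
  exists2 x, x \in r & forall y, y \in r -> (f y <= f x)%N.
Proof.
elim: r x0 => // y r IHr x0 _; case: r IHr => [_|z r IHr].
  by exists y; rewrite ?inE // => z; rewrite inE => /eqP ->.
have [x xr xmax] := IHr z (mem_head _ _).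
have [le_xy|/ltnW le_yx] := leqP (f x) (f y).
  exists y; first exact: mem_head.
  by move=> w; rewrite in_cons => /predU1P[->//|/xmax /leq_trans]; apply.
exists x; first by rewrite in_cons xr orbT.
by move=> w; rewrite in_cons => /predU1P[->//|/xmax].
Qed.

Section JacobiTrudi.
Variables (R : comNzRingType) (k : nat).
Implicit Types (p q : {mpoly R[k]}) (e : 'I_k -> nat) (s : 'S_k) (t u m : 'X_{1..k}).

Local Notation arho := (alternant R (@rho k)).

Lemma sympoly_valM (p q : sympoly R k) :
  sympoly_val (p * q) = sympoly_val p * sympoly_val q.
Proof. by []. Qed.

Lemma sympoly_valZ c (p : sympoly R k) : sympoly_val (c *: p) = c *: sympoly_val p.
Proof. by []. Qed.

Lemma sympoly_val_sum (I : Type) (r : seq I) (P : pred I) (F : I -> sympoly R k) :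
  sympoly_val (\sum_(i <- r | P i) F i) = \sum_(i <- r | P i) sympoly_val (F i).
Proof. exact: (raddf_sum val). Qed.

Definition hsym_shift N : sympoly R k := Sympoly (hs_sym R k N).

(** For e = lambda + rho the entry in row m and column i is h_(lambda_i - i + m), the transpose of
    the usual Jacobi-Trudi matrix. Arbitrary exponents are allowed so that unsorted and large ones
    can be straightened later. *)
Definition jacobi_trudi e : sympoly R k :=
  \det (\matrix_(m < k, i < k) hsym_shift (e i + m)).

Definition vmx : 'M[{mpoly R[k]}]_k := \matrix_(j, m) (vpolyD1 R j)`_m.

(** By [exp_var_vpolyD1] the matrix of the x_i^(e_j) factors as [vmx] times the Jacobi-Trudi
    matrix. *)
Lemma alternant_vmx e : alternant R e = \det vmx * sympoly_val (jacobi_trudi e).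
Proof.
rewrite /jacobi_trudi -[sympoly_val _]/(val _) -det_map_mx -det_mulmx; congr (\det _).
apply/matrixP => i j; rewrite !mxE (exp_var_vpolyD1 R i (e j)).
by apply: eq_bigr => m _; rewrite !mxE.
Qed.

(** The entries are h_(m-i), so the matrix is lower unitriangular. *)
Lemma jacobi_trudi_rho : jacobi_trudi (@rho k) = 1.
Proof.
rewrite /jacobi_trudi det_trig; last first.
  apply/is_trig_mxP => i j lt_ij; rewrite mxE; apply: val_inj => /=.
  rewrite /hs /hshift /rho leqNgt (_ : (_ < _)%N = true) //.
  by have := ltn_ord j; lia.
rewrite big1 // => i _; rewrite mxE; apply: val_inj => /=.
rewrite /hs /hshift /rho (_ : (k - i.+1 + i)%N = k.-1); last by have := ltn_ord i; lia.
by rewrite leqnn subnn hcompl0.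
Qed.

Lemma det_vmx : \det vmx = arho.
Proof. by rewrite alternant_vmx jacobi_trudi_rho mulr1. Qed.

Lemma alternant_jacobi_trudi e : alternant R e = sympoly_val (jacobi_trudi e) * arho.
Proof. by rewrite alternant_vmx det_vmx mulrC. Qed.

Definition mnmp e s : 'X_{1..k} := [multinom e (s i) | i < k].

Lemma alternantE e : alternant R e = \sum_(s : 'S_k) (-1) ^+ s *: 'X_[mnmp e s].
Proof.
apply: eq_bigr => s _; rewrite scaler_sign mulr_sign.
suff -> : \prod_i (\matrix_(i0, j) 'X_i0 ^+ e j) i (s i) = 'X_[mnmp e s] :> {mpoly R[k]} by [].
by rewrite mpolyXE_id; apply: eq_bigr => i _; rewrite !mxE mnmE.
Qed.

Lemma mcoeffM_alternant p e t :
  (p * alternant R e)@_t =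
  \sum_(s : 'S_k) (-1) ^+ s * (if (mnmp e s <= t)%MM then p@_(t - mnmp e s)%MM else 0).
Proof.
rewrite alternantE mulr_sumr raddf_sum /=; apply: eq_bigr => s _.
by rewrite -scalerAr mcoeffZ mcoeffMXE.
Qed.

(** In the term of the permutation s, the symmetric p may be replaced by its permuted copy, so that
    its monomials are rearranged in the same way as e. *)
Lemma sym_mul_alternant p e : p \is symmetric ->
  p * alternant R e = \sum_(u <- msupp p) p@_u *: alternant R (fun i => u i + e i)%N.
Proof.
move=> /issymP psym.
under eq_bigr => u _ do rewrite alternantE scaler_sumr.
rewrite exchange_big alternantE mulr_sumr /=; apply: eq_bigr => s _.
rewrite -{1}(psym s^-1%g) {1}(mpolyE p) raddf_sum /= -scalerAr mulr_suml scaler_sumr.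
apply: eq_bigr => u _; rewrite msymZ msymX invgK -scalerAl scalerA mulrC -scalerA -mpolyXD.
by congr (_ *: (_ *: 'X_[_])); apply/mnmP => i; rewrite !mnmE.
Qed.

Lemma rho_inj : injective (@rho k).
Proof.
move=> i j; rewrite /rho => ij; apply: val_inj => /=.
by have := ltn_ord i; have := ltn_ord j; lia.
Qed.

Definition mrho : 'X_{1..k} := [multinom rho i | i < k].

(** Sum the inequalities 2xy <= x^2 + y^2 with x = rho (s i) and y = rho i; equality throughout
    would force s = 1, as rho is injective. *)
Lemma rearrangement_rho s : s != 1%g ->
  (\sum_i mnmp (@rho k) s i * rho i < \sum_i mrho i * rho i)%N.
Proof.
move=> s1; rewrite -(ltn_pmul2l (isT : 0 < 2)%N).
have -> : (2 * \sum_i mrho i * rho i = \sum_i (rho (s i) ^ 2 + rho i ^ 2))%N.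
  rewrite big_split /= mul2n -addnn [in RHS]addnC.
  by congr addn; last rewrite (reindex_perm s); apply: eq_bigr => i _; rewrite mnmE mulnn.
rewrite big_distrr /=; under eq_bigr => i _ do rewrite mnmE.
have := leqif_sum (fun i (_ : true) => nat_Cauchy (rho (s i)) (rho i)).
case=> le_sum eq_sum; rewrite ltn_neqAle le_sum eq_sum andbT.
apply: contra s1 => /forallP /= eq_s; apply/eqP/perm.permP => i.
by apply: rho_inj; rewrite perm1; apply/eqP/eq_s.
Qed.

(* A monomial [u] of [p] maximal for [f], and then for the pairing with rho, meets only
   the diagonal term of [arho]. *)
Lemma msuppM_rho (f : 'X_{1..k} -> nat) p :
    (forall t u, f (t + u)%MM = f t + f u)%N ->
    (forall s, f (mnmp (@rho k) s) <= f mrho)%N -> p != 0 ->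
  exists u, [/\ u \in msupp p, forall v, v \in msupp p -> (f v <= f u)%N
              & (u + mrho)%MM \in msupp (p * arho)].
Proof.
move=> fD frho p0.
have [u0 u0p] : exists u0, u0 \in msupp p by exists (mlead p); apply: mlead_supp.
have [u1 u1p fmax] := exists_argmax f u0p.
pose g (t : 'X_{1..k}) := (\sum_i t i * rho i)%N.
have gD t u : (g (t + u)%MM = g t + g u)%N.
  by rewrite -big_split; apply: eq_bigr => i _; rewrite mnmDE mulnDl.
have u1in : u1 \in [seq v <- msupp p | f v == f u1] by rewrite mem_filter eqxx.
have [u] := exists_argmax g u1in; rewrite mem_filter => /andP[/eqP fu up] gmax.
exists u; split=> // [v /fmax|]; first by rewrite fu.
rewrite mcoeff_msupp mcoeffM_alternant (bigD1 1%g) //= [X in _ + X]big1 ?addr0.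
  rewrite odd_perm1 expr0 mul1r (_ : mnmp _ _ = mrho); last first.
    by apply/mnmP => i; rewrite !mnmE perm1.
  by rewrite lem_addl addmK -mcoeff_msupp.
(* A contribution of s != 1 needs a monomial w of p with w + s(rho) = u + rho. Then f is maximal at
   w too, and [rearrangement_rho] gives g w > g u, against the choice of u. *)
move=> s s1; case: ifP => [le_s|]; last by rewrite mulr0.
rewrite memN_msupp_eq0 ?mulr0 //; apply/negP.
set w := (_ - _)%MM => wp; have wE : (w + mnmp (@rho k) s = u + mrho)%MM by apply: submK.
have fw : f w = f u1.
  apply/eqP; rewrite eqn_leq fmax //= -fu.
  by have := congr1 f wE; rewrite !fD; have := frho s; lia.
have := gmax w; rewrite mem_filter fw eqxx => /(_ wp).
by have := congr1 g wE; rewrite !gD; have := rearrangement_rho s1; rewrite -!/(g _); lia.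
Qed.

(** With the zero weight, [msuppM_rho] finds a monomial of [p * arho] as soon as p is nonzero, even
    if R has zero divisors. *)
Lemma arho_reg p : p * arho = 0 -> p = 0.
Proof.
move=> p_rho; apply/eqP; apply: contraT => p0.
have [|||u [_ _]] := @msuppM_rho (fun=> 0%N) p; rewrite ?p0 //.
by rewrite p_rho msupp0.
Qed.

Lemma arho_inj : injective (fun p => p * arho).
Proof.
by move=> p q /eqP; rewrite -subr_eq0 -mulrBl => /eqP /arho_reg /eqP; rewrite subr_eq0 => /eqP.
Qed.

Lemma sympoly_arho_inj (p q : sympoly R k) :
  sympoly_val p * arho = sympoly_val q * arho -> p = q.
Proof. by move=> /arho_inj; apply: val_inj. Qed.

(** Divide [sym_mul_alternant] for e = rho by a_rho. The determinants [jacobi_trudi] thus span all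
    symmetric polynomials. *)
Lemma sympoly_jacobi_trudi (p : sympoly R k) :
  p = \sum_(u <- msupp p) p@_u *: jacobi_trudi (fun i => u i + rho i)%N.
Proof.
apply: sympoly_arho_inj; rewrite (sym_mul_alternant _ (sympoly_valP p)).
rewrite sympoly_val_sum mulr_suml; apply: eq_bigr => u _.
by rewrite alternant_jacobi_trudi sympoly_valZ scalerAl.
Qed.

(** The Jacobi-Trudi determinant witnesses that the quotient named by [schur] exists. *)
Lemma schurP (la : 'I_k -> nat) :
  sympoly_val (schur R la) * arho = alternant R (fun j => la j + rho j)%N.
Proof.
rewrite /schur; apply: (epsilon_spec (inhabits 0) (fun s : sympoly R k =>
  sympoly_val s * arho = alternant R (fun j => la j + rho j)%N)).
by exists (jacobi_trudi (fun j => la j + rho j)%N); rewrite -alternant_jacobi_trudi.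
Qed.

Lemma schurE la : schur R la = jacobi_trudi (fun j => la j + rho j)%N.
Proof. by apply: sympoly_arho_inj; rewrite schurP alternant_jacobi_trudi. Qed.

(** [msuppM_rho] with the total degree as weight: the top degree does not cancel on multiplying by
    a_rho. *)
Lemma mdeg_lt_arho p u : u \in msupp p -> (mdeg u + mdeg mrho < msize (p * arho))%N.
Proof.
move=> up; have p0 : p != 0 by apply: contraTneq up => ->; rewrite msupp0.
have [|v [_ vmax vp]] := @msuppM_rho mdeg p mdegD _ p0.
  move=> s; rewrite !mdegE [leqRHS](reindex_inj (@perm_inj _ s)).
  by apply: eq_leq; apply: eq_bigr => i _; rewrite !mnmE.
by apply: leq_ltn_trans (msize_mdeg_lt vp); rewrite mdegD leq_add2r vmax.
Qed.

End JacobiTrudi.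

(** * Bounds for an additive weight on the support *)

Section SupportBound.
Variables (R : comNzRingType) (k : nat) (f : 'X_{1..k} -> nat).
Hypotheses (f0 : f 0%MM = 0%N) (fD : forall t u, f (t + u)%MM = (f t + f u)%N).
Implicit Types (p q : {mpoly R[k]}).

(** The weight f is left abstract: it is later the total degree, or the degree in a subset of the
    variables. *)
Definition supp_le p d := forall t, t \in msupp p -> (f t <= d)%N.

Lemma supp_leW p c d : (c <= d)%N -> supp_le p c -> supp_le p d.
Proof. by move=> le_cd pc t /pc /leq_trans; apply. Qed.

Lemma supp_le0 d : supp_le 0 d.
Proof. by move=> t; rewrite msupp0. Qed.

Lemma supp_le1 d : supp_le 1 d.
Proof. by move=> t; rewrite msupp1 inE => /eqP ->; rewrite f0. Qed.

Lemma supp_leD p q d : supp_le p d -> supp_le q d -> supp_le (p + q) d.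
Proof. by move=> pd qd t /msuppD_le; rewrite mem_cat => /orP[/pd|/qd]. Qed.

Lemma supp_leZ (c : R) p d : supp_le p d -> supp_le (c *: p) d.
Proof. by move=> pd t /msuppZ_le /pd. Qed.

Lemma supp_leM p q c d : supp_le p c -> supp_le q d -> supp_le (p * q) (c + d).
Proof.
by move=> pc qd t /msuppM_le /allpairsP[[u v] [/= /pc uc /qd vd ->]]; rewrite fD leq_add.
Qed.

Lemma supp_leXU i c : supp_le ('X_i ^+ c) (c * f U_(i)%MM).
Proof.
elim: c => [|c IHc]; first exact: supp_le1.
rewrite exprS mulSn; apply: supp_leM => // t.
by rewrite msuppX inE => /eqP ->.
Qed.

Lemma supp_leX p c d : supp_le p d -> supp_le (p ^+ c) (c * d).
Proof.
move=> pd; elim: c => [|c IHc]; first exact: supp_le1.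
by rewrite exprS mulSn; apply: supp_leM.
Qed.

Lemma supp_le_sum (I : Type) (r : seq I) (P : pred I) (F : I -> {mpoly R[k]}) d :
  (forall i, P i -> supp_le (F i) d) -> supp_le (\sum_(i <- r | P i) F i) d.
Proof.
move=> Fd; elim/big_ind: _ => //; [exact: supp_le0|by move=> p q; exact: supp_leD].
Qed.

Lemma supp_le_prod (I : Type) (r : seq I) (P : pred I) (F : I -> {mpoly R[k]}) d :
  (forall i, P i -> supp_le (F i) (d i)) ->
  supp_le (\prod_(i <- r | P i) F i) (\sum_(i <- r | P i) d i).
Proof.
move=> Fd; elim/big_ind2: _ => //; first exact: supp_le1.
by move=> p c q c' pc qc; apply: supp_leM.
Qed.

Lemma supp_le_det n (M : 'M[{mpoly R[k]}]_n) d : (forall i j, supp_le (M i j) (d j)) ->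
  supp_le (\det M) (\sum_j d j).
Proof.
move=> Md; apply: supp_le_sum => s _; rewrite mulr_sign (reindex_perm s^-1%g) /=.
have H : supp_le (\prod_i M (s^-1%g i) (s (s^-1%g i))) (\sum_j d j).
  by apply: supp_le_prod => i _; rewrite permKV; apply: Md.
by case: (odd_perm s) => //; rewrite -scaleN1r; apply: supp_leZ.
Qed.

End SupportBound.

(** * Straightening and reducing alternants *)

Section Alternants.
Variables (R : comNzRingType) (k : nat).
Implicit Types (e d : 'I_k -> nat) (s : 'S_k) (t u : 'X_{1..k}).

Local Notation arho := (alternant R (@rho k)).

Lemma msupp_alternant e t : t \in msupp (alternant R e) -> exists s, t = mnmp e s.
Proof.
rewrite alternantE => /msupp_sum_le /flattenP[r /mapP[s _ ->]] /msuppZ_le.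
by rewrite msuppX inE => /eqP ->; exists s.
Qed.

(** Weigh by the exponent of the first variable: a_rho adds its full k - 1 to the maximum, while
    a_(lambda+rho) has exponents at most b + k - 1. Symmetry carries the bound to the other
    variables. *)
Lemma msupp_schur_le (la : 'I_k -> nat) b u i : (forall j, la j <= b)%N ->
  u \in msupp (schur R la) -> (u i <= b)%N.
Proof.
move=> lab up; have k0 : (0 < k)%N by apply: leq_ltn_trans (ltn_ord i).
pose i0 := Ordinal k0; pose f (t : 'X_{1..k}) := t i0.
have rho_i0 j : (@rho k j <= rho i0)%N by rewrite /rho /i0 /=; lia.
have s0 : sympoly_val (schur R la) != 0 by apply: contraTneq up => ->; rewrite msupp0.
have [||v [vp vmax]] := @msuppM_rho R k f _ _ _ s0.
- by move=> t w; rewrite /f mnmDE.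
- by move=> s; rewrite /f !mnmE.
rewrite schurP => /msupp_alternant[s] /mnmP /(_ i0); rewrite mnmDE !mnmE => vE.
have vb : (v i0 <= b)%N by have := rho_i0 (s i0); have := lab (s i0); lia.
apply: leq_trans vb.
have -> : u i = f [multinom u (tperm i0 i j) | j < k] by rewrite /f mnmE tpermL.
by apply: vmax; rewrite issym_msupp // sympoly_valP.
Qed.

Lemma eq_jacobi_trudi e d : e =1 d -> jacobi_trudi R e = jacobi_trudi R d.
Proof. by move=> ed; congr (\det _); apply/matrixP => i j; rewrite !mxE ed. Qed.

Lemma jacobi_trudi_perm e s :
  jacobi_trudi R (fun i => e (s i)) = (-1) ^+ s *: jacobi_trudi R e.
Proof.
rewrite /jacobi_trudi; set M := \matrix_(m, i) hsym_shift R k (e i + m).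
rewrite (_ : \matrix_(_, _) _ = col_perm s M); last by apply/matrixP => i j; rewrite !mxE.
by rewrite col_permE det_mulmx det_perm odd_permV mulrC scaler_sign mulr_sign.
Qed.

Lemma jacobi_trudi_eq0 e : ~ injective e -> jacobi_trudi R e = 0.
Proof.
move=> /injectiveP /injectivePn[i [j ij eij]].
rewrite /jacobi_trudi -det_tr (determinant_alternate ij) // => m.
by rewrite !mxE eij.
Qed.

Lemma sorting_perm e : injective e ->
  exists s : 'S_k, forall i j : 'I_k, (i < j)%N -> (e (s j) < e (s i))%N.
Proof.
(* The rank of i in decreasing order is the number of larger values. *)
move=> e_inj; pose above i := [set j | (e i < e j)%N].
have above_lt i : (#|above i| < k)%N.
  rewrite -[X in (_ < X)%N]card_ord -cardsT proper_card //.
  by apply/properP; split; [exact: subsetT|exists i; rewrite !inE ?ltnn].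
have above_mono i j : (e i < e j)%N -> (#|above j| < #|above i|)%N.
  move=> lt_ij; apply: proper_card; apply/properP; split.
    by apply/subsetP => l; rewrite !inE; apply: ltn_trans.
  by exists j; rewrite !inE ?ltnn.
pose r i := Ordinal (above_lt i).
have r_inj : injective r.
  move=> i j [rij]; apply: e_inj.
  by case: (ltngtP (e i) (e j)) => // /above_mono; rewrite rij ltnn.
exists (perm r_inj)^-1%g => i j; rewrite -{1}(permKV (perm r_inj) i) -{1}(permKV (perm r_inj) j).
move: ((perm r_inj)^-1%g i) ((perm r_inj)^-1%g j) => {}i {}j; rewrite !permE /=.
by case: (ltngtP (e j) (e i)) => // [/above_mono|/e_inj ->]; rewrite ?ltnn //; case: ltngtP.
Qed.

Lemma decreasing_gap d : (forall i j : 'I_k, (i < j)%N -> (d j < d i)%N) ->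
  forall i j : 'I_k, (i <= j)%N -> (d j + (j - i) <= d i)%N.
Proof.
move=> ddec i j le_ij; have [l lE] : exists l, (j - i = l)%N by eexists.
elim: l j le_ij lE => [|l IHl] j le_ij lE.
  by rewrite lE addn0 (_ : i = j) //; apply: val_inj => /=; lia.
have lt_j : (j.-1 < k)%N by have := ltn_ord j; lia.
have := IHl (Ordinal lt_j); have := ddec (Ordinal lt_j) j => /=; lia.
Qed.

Definition upd e (i0 : 'I_k) c i := if i == i0 then c else e i.

Section Replace.
Variables (e : 'I_k -> nat) (i0 : 'I_k).

Definition replmx (v : 'I_k -> {mpoly R[k]}) : 'M_k :=
  \matrix_(i, j) (if j == i0 then v i else 'X_i ^+ e j).

(** The cofactors along column i0 ignore that column, so a zero column can stand in for v; this
    exhibits linearity in v. *)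
Lemma det_replmx v : \det (replmx v) = \sum_i v i * cofactor (replmx (fun=> 0)) i i0.
Proof.
rewrite (expand_det_col _ i0); apply: eq_bigr => i _; rewrite !mxE eqxx; congr (_ * (_ * \det _)).
by apply/matrixP => l j; rewrite !mxE eq_sym (negPf (neq_lift _ _)).
Qed.

Lemma alternant_upd c : alternant R (upd e i0 c) = \det (replmx (fun i => 'X_i ^+ c)).
Proof. by congr (\det _); apply/matrixP => i j; rewrite !mxE /upd; case: ifP. Qed.

End Replace.

Section Reduction.
Variables (n : nat) (e : 'I_k -> nat) (i0 : 'I_k).
Hypotheses (le_kn : (k <= n)%N) (le_ne : (n <= e i0)%N).

Definition vcoef m : sympoly R k := Sympoly (vpoly_coef_sym R k m).

(** By [reduct_arho], this is the quotient by a_rho of the alternant whose column i0 is multiplied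
    by [t^m] \prod_(l != i) (t - x_l) in place of x_i^n. *)
Definition reduct m : sympoly R k :=
  \sum_(s < k) vcoef (m + s.+1) * jacobi_trudi R (upd e i0 (e i0 - n + s)).

Lemma reduct_arho m : sympoly_val (reduct m) * arho =
  \det (replmx e i0 (fun i => 'X_i ^+ (e i0 - n) * (vpolyD1 R i)`_m)).
Proof.
rewrite sympoly_val_sum mulr_suml det_replmx.
transitivity (\sum_(s < k) (vpoly R k)`_(m + s.+1) *
   \sum_i 'X_i ^+ (e i0 - n + s) * cofactor (replmx e i0 (fun=> 0)) i i0).
  apply: eq_bigr => s _; rewrite -det_replmx -alternant_upd (alternant_jacobi_trudi R (upd _ _ _)).
  by rewrite sympoly_valM mulrA.
under eq_bigr do rewrite mulr_sumr.
rewrite exchange_big; apply: eq_bigr => i _ /=; rewrite coef_vpolyD1 mulr_sumr mulr_suml.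
by apply: eq_bigr => s _; rewrite exprD; ring.
Qed.

(** Expand x_i^n in column i0 by [exp_var_vpolyD1]. The coefficients h_(n-k+m+1) are the ones that
    become scalars modulo I. *)
Lemma jacobi_trudi_reduct :
  jacobi_trudi R e = \sum_(m < k) hsym R k (n - k + m.+1) * reduct m.
Proof.
apply: sympoly_arho_inj; rewrite -alternant_jacobi_trudi sympoly_val_sum mulr_suml.
under eq_bigr do rewrite sympoly_valM -mulrA reduct_arho det_replmx mulr_sumr.
have -> : alternant R e = alternant R (upd e i0 (e i0)).
  by congr (\det _); apply/matrixP => i j; rewrite !mxE /upd; case: eqP => [->|].
rewrite alternant_upd det_replmx exchange_big; apply: eq_bigr => i _ /=.
rewrite -{1}(subnK le_ne) exprD (exp_var_vpolyD1 R i n) mulr_sumr mulr_suml.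
apply: eq_bigr => m _; rewrite /hs /hshift.
have -> : (k.-1 <= n + m)%N by lia.
rewrite hcomplT (_ : (n + m - k.-1)%N = (n - k + m.+1)%N); first by ring.
by have := ltn_ord m; lia.
Qed.

(** Column i0 loses n and regains at most k - 1, so the degree drops strictly. *)
Lemma reduct_deg m : supp_le mdeg (sympoly_val (reduct m) * arho) (\sum_i e i - n + k.-1).
Proof.
rewrite reduct_arho.
apply: (@supp_leW _ _ _ _ (\sum_i upd e i0 (e i0 - n + k.-1) i)).
  rewrite (bigD1 i0) //= [in leqRHS](bigD1 i0) //= {1}/upd eqxx.
  rewrite (eq_bigr e); first by lia.
  by move=> i /negPf ii0; rewrite /upd ii0.
apply: (@supp_le_det R k mdeg (@mdeg0 k) (@mdegD k) k _ (upd e i0 (e i0 - n + k.-1))) => i j.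
rewrite mxE /upd; have Xdeg c : supp_le mdeg ('X_i ^+ c : {mpoly R[k]}) c.
  by have := @supp_leXU R k mdeg (@mdeg0 k) (@mdegD k) i c; rewrite mdeg1 muln1.
case: ifP => // _; apply: (supp_leM (@mdegD _)) => // t /msupp_coef_vpolyD1[+ _ _].
lia.
Qed.

End Reduction.
End Alternants.

(** * The Schur classes span the quotient *)

Section Spanning.
Variables (R : comNzRingType) (k n : nat) (a : 'I_k -> R).
Hypothesis (le_kn : (k <= n)%N).

Lemma symprojZ c p : symproj n a (c *: p) = c *: symproj n a p.
Proof. exact: esym (symproj_scale n a c p). Qed.

Definition in_span (x : symquot n a) :=
  exists c : boxpart k n -> R, x = \sum_la c la *: schurbar a la.

Lemma in_span0 : in_span 0.
Proof. by exists (fun=> 0); rewrite big1 // => la _; rewrite scale0r. Qed.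

Lemma in_spanD x y : in_span x -> in_span y -> in_span (x + y).
Proof.
move=> [c ->] [d ->]; exists (fun la => c la + d la).
by rewrite -big_split; apply: eq_bigr => la _; rewrite scalerDl.
Qed.

Lemma in_spanZ b x : in_span x -> in_span (b *: x).
Proof.
move=> [c ->]; exists (fun la => b * c la).
by rewrite scaler_sumr; apply: eq_bigr => la _; rewrite scalerA.
Qed.

Lemma in_span_schurbar la : in_span (schurbar a la).
Proof.
exists (fun mu => (mu == la)%:R); rewrite (bigD1 la) //= eqxx scale1r big1 ?addr0 //.
by move=> mu /negPf ->; rewrite scale0r.
Qed.

(** Repeated exponents give 0; distinct ones, sorted and diminished by rho, form a partition in the
    box. *)
Lemma in_span_jacobi_trudi (e : 'I_k -> nat) : (forall i, e i < n)%N ->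
  in_span (symproj n a (jacobi_trudi R e)).
Proof.
move=> lt_en; have [/injectiveP e_inj|/injectiveP e_ninj] := boolP (injectiveb e); last first.
  by rewrite (jacobi_trudi_eq0 _ e_ninj) raddf0; apply: in_span0.
have [s s_dec] := sorting_perm e_inj.
have gap := decreasing_gap s_dec.
(* Comparison with the last and the first entry yields rho i <= e (s i) <= n - k + rho i. *)
have lo (i : 'I_k) : (k <= e (s i) + i.+1)%N.
  have lt_k : (k.-1 < k)%N by have := ltn_ord i; lia.
  by have := gap i (Ordinal lt_k) => /=; have := ltn_ord i; lia.
have hi (i : 'I_k) : (e (s i) + i < n)%N.
  have lt_0 : (0 < k)%N by have := ltn_ord i; lia.
  by have := gap (Ordinal lt_0) i => /=; have := lt_en (s (Ordinal lt_0)); lia.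
pose f := [ffun i : 'I_k => inord (e (s i) - rho i) : 'I_(n - k).+1].
have fE i : f i = (e (s i) - rho i)%N :> nat.
  rewrite ffunE inordK // ltnS /rho.
  by have := lo i; have := hi i; have := ltn_ord i; lia.
have f_dec : [forall i : 'I_k, forall j : 'I_k, (i <= j)%N ==> (f j <= f i)%N].
  apply/'forall_forallP => i j; apply/implyP => le_ij; rewrite !fE /rho.
  by have := gap i j le_ij; have := lo i; have := lo j; have := ltn_ord i; have := ltn_ord j; lia.
have -> : jacobi_trudi R e = (-1) ^+ s *: jacobi_trudi R (fun i => e (s i)).
  by rewrite jacobi_trudi_perm scalerA -expr2 sqrr_sign scale1r.
rewrite symprojZ; apply: in_spanZ.
rewrite (_ : symproj n a _ = schurbar a (Boxpart f_dec)); first exact: in_span_schurbar.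
rewrite /schurbar schurE; congr symproj; apply: eq_jacobi_trudi => i.
by rewrite /parts /= fE subnK // /rho; have := lo i; lia.
Qed.

Lemma symproj_hsym (i : 'I_k) p :
  symproj n a (hsym R k (n - k + i.+1) * p) = a i *: symproj n a p.
Proof.
apply/eqP; rewrite -symprojZ symproj_eq -mulr_algl -mulrBl mulrC.
apply: idealI_mull; apply/idealIP; exists (fun j => (j == i)%:R).
by rewrite (bigD1 i) //= eqxx mul1r big1 ?addr0 // => j /negPf ->; rewrite mul0r.
Qed.

(** Induction on the size of p a_rho: expand p into Jacobi-Trudi determinants; one with an exponent
    at least n is rewritten by [jacobi_trudi_reduct] into terms of lower degree. *)
Lemma symproj_in_span p : in_span (symproj n a p).
Proof.
have [d] : exists d, (msize (sympoly_val p * alternant R (@rho k)) <= d)%N by eexists.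
elim: d p => [|d IHd] p le_d.
  suff -> : p = 0 by rewrite raddf0; apply: in_span0.
  by apply/val_inj/arho_reg/eqP; rewrite -msize_poly_eq0 -leqn0.
rewrite (sympoly_jacobi_trudi p) raddf_sum /= big_seq_cond.
elim/big_ind: _ => [||u /andP[up _]]; [exact: in_span0|exact: in_spanD|].
rewrite symprojZ; apply: in_spanZ; set e := fun i => _.
have e_d : (\sum_i e i <= d)%N.
  rewrite -ltnS; apply: leq_trans le_d; apply: leq_ltn_trans (mdeg_lt_arho up).
  rewrite !mdegE -big_split; apply: eq_leq; apply: eq_bigr => i _.
  by rewrite /= mnmE.
have [lt_en|] := boolP [forall i, e i < n]%N.
  by apply: in_span_jacobi_trudi => i; apply: (forallP lt_en).
rewrite negb_forall => /existsP[i0]; rewrite -leqNgt => le_ne.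
rewrite (jacobi_trudi_reduct R le_kn le_ne) raddf_sum /=.
elim/big_ind: _ => [||m _]; [exact: in_span0|exact: in_spanD|].
rewrite symproj_hsym; apply/in_spanZ/IHd.
apply/bigmax_leqP_seq => t tp _; rewrite -[X in (X <= _)%N]/(mdeg t).+1.
have := reduct_deg le_kn le_ne tp.
have : (e i0 <= \sum_i e i)%N by rewrite (bigD1 i0) //= leq_addr.
by have := ltn_ord i0; lia.
Qed.

End Spanning.

(** * Sums of distinct numbers, and reindexing of sums over exponents *)

Lemma sum_uniq_nat (r : seq nat) : uniq r ->
  (size r * (size r).-1 <= 2 * \sum_(x <- r) x)%N.
Proof.
move sz : (size r) => c; elim: c r sz => [|c IHc] r sz ur //.
(* Pigeonhole: c + 1 distinct numbers cannot all lie below c. *)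
have [x xr le_cx] : exists2 x, x \in r & (c <= x)%N.
  apply/hasP; rewrite -[has _ _]negbK -all_predC; apply/negP => /allP r_lt.
  have /(uniq_leq_size ur) : {subset r <= iota 0 c}.
    by move=> x /r_lt /=; rewrite mem_iota /= -ltnNge.
  by rewrite size_iota sz ltnn.
rewrite (perm_big _ (perm_to_rem xr)) big_cons /=.
have := IHc (rem x r); rewrite size_rem // sz => /(_ erefl (rem_uniq x ur)).
case: c {IHc sz} le_cx => [|c] //= le_cx; lia.
Qed.

Lemma sum_inj_nat (T : finType) (A : {set T}) (g : T -> nat) : {in A &, injective g} ->
  (#|A| * #|A|.-1 <= 2 * \sum_(i in A) g i)%N.
Proof.
move=> g_inj; have := @sum_uniq_nat (map g (enum A)).
rewrite size_map -cardE big_map big_enum; apply.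
rewrite map_inj_in_uniq ?enum_uniq // => i j.
by rewrite !mem_enum; apply: g_inj.
Qed.

Section BoundedMultinomialSums.
Variables (V : nmodType) (k : nat).
Implicit Types (F : 'X_{1..k} -> V).

Lemma big_bmnm_widen F b b' : (b <= b')%N ->
  \sum_(m : 'X_{1..k < b}) F m = \sum_(m : 'X_{1..k < b'} | (mdeg m < b)%N) F m.
Proof.
move=> le_b; have lt_b' (m : 'X_{1..k < b}) : (mdeg m < b')%N by apply: leq_trans (bmdeg m) le_b.
rewrite (reindex_omap (fun m => BMultinom (lt_b' m))
  (fun m : 'X_{1..k < b'} => insub (val m))) /=; last first.
  by move=> m lt_m; rewrite insubT /=; congr Some; apply: val_inj.
apply: eq_bigl => m; rewrite bmdeg /= insubT ?bmdeg //= => lt_m.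
by apply/esym/eqP; congr Some; apply: val_inj.
Qed.

Lemma big_bmnm_shift F b j :
  \sum_(m : 'X_{1..k < b.+1} | m j != 0%N) F (m - U_(j))%MM =
  \sum_(m : 'X_{1..k < b}) F m.
Proof.
have lt_b (m : 'X_{1..k < b}) : (mdeg (m + U_(j))%MM < b.+1)%N.
  by rewrite mdegD mdeg1 addn1 ltnS bmdeg.
rewrite (reindex_omap (fun m => BMultinom (lt_b m))
  (fun m : 'X_{1..k < b.+1} => insub (m - U_(j))%MM)) /=; last first.
  move=> m mj; have le_jm : (U_(j) <= m)%MM by rewrite lep1mP.
  have lt_m : (mdeg (m - U_(j))%MM < b)%N.
    by have := bmdeg m; rewrite -{1}(submK le_jm) mdegD mdeg1 addn1.
  by rewrite insubT /=; congr Some; apply: val_inj; rewrite /= submK.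
apply: eq_big => [m|m _]; last by rewrite addmK.
rewrite mnmDE mnm1E eqxx addn1 /= addmK insubT ?bmdeg // => lt_m.
by apply/eqP; congr Some; apply: val_inj.
Qed.

End BoundedMultinomialSums.

(** * The residue form and its vanishing on I *)

Section Residue.
Variables (R : comNzRingType) (k n : nat) (a : 'I_k -> R).
Hypothesis (le_kn : (k <= n)%N).
Implicit Types (p q : {mpoly R[k]}) (m t : 'X_{1..k}).

Local Notation arho := (alternant R (@rho k)).

(** The polynomial F_j is x_j^n minus this one. *)
Definition lowpart j : {mpoly R[k]} := \sum_(m < k) a m *: (vpolyD1 R j)`_m.

Definition lowprod m : {mpoly R[k]} := \prod_j lowpart j ^+ m j.

(* The exponents of x^(omega + rho). *)
Definition tau : 'X_{1..k} := [multinom n - i.+1 | i < k].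

(* The coefficient of x^tau in q \prod_j (lowpart j / x_j^n)^(m j), the m-th term of the expansion
   of q / \prod_j (1 - lowpart j / x_j^n); it vanishes once |m| reaches [msize q]. *)
Definition residue_term q m : R := (q * lowprod m)@_(tau + m *+ n)%MM.

Definition residue q : R := \sum_(m : 'X_{1..k < msize q}) residue_term q m.

(** The bound is asked only where m_j > 0, since in [residue_small] it holds only for those j. *)
Lemma supp_le_lowprod (f : 'X_{1..k} -> nat) (d : 'I_k -> nat) m :
    f 0%MM = 0%N -> (forall t u, f (t + u)%MM = f t + f u)%N ->
    (forall j l, m j != 0%N -> supp_le f (vpolyD1 R j)`_l (d j)) ->
  supp_le f (lowprod m) (\sum_j m j * d j).
Proof.
move=> f0 fD fd; apply: supp_le_prod => // j _.
have [mj|mj] := eqVneq (m j) 0%N; first by rewrite mj mul0n expr0; apply: supp_le1.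
apply: supp_leX => //; apply: supp_le_sum => l _; apply: supp_leZ; exact: fd.
Qed.

(** [lowprod m] has degree at most |m| (k - 1), while the target exponent has degree at least |m| n;
    for k > 0 the gap of at least |m| exceeds the degree of q. *)
Lemma residue_term_eq0 q m : (msize q <= mdeg m)%N -> residue_term q m = 0.
Proof.
move=> le_qm; apply/eqP; rewrite mcoeff_eq0; apply/negP.
move=> /msuppM_le /allpairsP[[u v] [/= /msize_mdeg_lt uq vm]] /(congr1 mdeg).
have := supp_le_lowprod (d := fun=> k.-1) (@mdeg0 k) (@mdegD k) _ vm.
rewrite !mdegD mdegMn -big_distrl /= -mdegE => vq.
have {}vm : (mdeg v <= mdeg m * k.-1)%N.
  by apply: vq => j l _ t /msupp_coef_vpolyD1[+ _ _]; lia.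
have : (mdeg m * k <= mdeg m * n)%N by rewrite leq_mul2l le_kn orbT.
have [k0|k0] := posnP k; last first.
  have : (mdeg m * k = mdeg m + mdeg m * k.-1)%N by rewrite -mulnS prednK.
  by move: (mdeg m) (mdeg u) (mdeg v) (mdeg tau) le_qm uq vm; lia.
have m0 : mdeg m = 0%N by rewrite mdegE big1 // => i; have := ltn_ord i; lia.
by move: le_qm uq; rewrite m0 leqn0 => /eqP ->.
Qed.

Lemma residueE b q : (msize q <= b)%N ->
  residue q = \sum_(m : 'X_{1..k < b}) residue_term q m.
Proof.
move=> le_b; rewrite /residue (big_bmnm_widen _ le_b) big_mkcond /=.
by apply: eq_bigr => m _; case: ltnP => // /residue_term_eq0.
Qed.

Lemma residueP c q r : residue (c *: q + r) = c * residue q + residue r.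
Proof.
pose b := (msize (c *: q + r) + msize q + msize r)%N.
rewrite !(@residueE b) /b; try lia.
rewrite mulr_sumr -big_split; apply: eq_bigr => m _.
by rewrite /residue_term mulrDl -scalerAl mcoeffD mcoeffZ.
Qed.

Lemma residue_sum (I : Type) (r : seq I) (F : I -> {mpoly R[k]}) :
  residue (\sum_(i <- r) F i) = \sum_(i <- r) residue (F i).
Proof.
elim: r => [|i r IHr].
  by rewrite !big_nil /residue big1 // => m _; rewrite /residue_term mul0r mcoeff0.
by rewrite !big_cons -{1}[F i]scale1r residueP mul1r IHr.
Qed.

(** The factor x_j^n cancels one division by x_j^n and leaves one factor [lowpart j] over. If m_j =
    0, the target exponent of x_j is tau_j < n and nothing contributes. *)
Lemma residue_term_exp q m j : residue_term (q * 'X_j ^+ n) m =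
  if m j != 0%N then residue_term (q * lowpart j) (m - U_(j))%MM else 0.
Proof.
rewrite /residue_term mulrAC mpolyXn mcoeffMXE; have [mj|] := boolP (m j != 0%N).
  have le_jm : (U_(j) <= m)%MM by rewrite lep1mP.
  have mE : m = (m - U_(j) + U_(j))%MM by rewrite (submK le_jm).
  rewrite (_ : (U_(j) *+ n <= _)%MM); last first.
    apply/mnm_lepP => i; rewrite mnmDE !mulmnE mnm1E; case: eqP => [<-|_] //.
    by rewrite mul1n (leq_trans _ (leq_addl _ _)) // leq_pmull // lt0n.
  rewrite (_ : (_ - U_(j) *+ n)%MM = (tau + (m - U_(j)) *+ n)%MM); last first.
    apply/mnmP => i; rewrite mnmBE !mnmDE !mulmnE mnmBE mulnBl addnBA //.
    by rewrite leq_mul2r mnm1E; case: (j =P i) => [<-|_]; rewrite ?lt0n ?mj orbT.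
  congr (_@__); rewrite -mulrA; congr (_ * _); rewrite {1}mE /lowprod.
  rewrite (bigD1 j) //= [in RHS](bigD1 j) //= mulrA -exprS mnmDE mnm1E eqxx addn1.
  congr (_ * _); apply: eq_bigr => i ij; rewrite mnmDE mnm1E [j == i]eq_sym (negPf ij).
  by rewrite addn0.
rewrite negbK => /eqP mj; case: ifP => // /mnm_lepP /(_ j).
rewrite mnmDE !mulmnE mj mnm1E mnmE eqxx mul0n mul1n addn0.
by have := ltn_ord j; lia.
Qed.

(** The geometric series telescopes: the terms of q x_j^n are those of q [lowpart j] with m raised
    by one at j, hence the ranges b + 1 and b. *)
Lemma residue_relation q j : residue (q * ('X_j ^+ n - lowpart j)) = 0.
Proof.
rewrite mulrBr addrC -scaleN1r residueP mulN1r addrC; apply/eqP; rewrite subr_eq0; apply/eqP.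
pose b := (msize (q * 'X_j ^+ n) + msize (q * lowpart j))%N.
rewrite (@residueE b.+1 (q * 'X_j ^+ n)) ?leqW ?leq_addr //.
rewrite (@residueE b (q * lowpart j)) ?leq_addl //.
under eq_bigr do rewrite residue_term_exp.
rewrite -big_mkcond /=.
exact: (big_bmnm_shift (fun m => residue_term (q * lowpart j) m)).
Qed.

(** [vmx] maps the column of generators to the column of the F_j; its adjugate then writes a_rho
    times a generator as a combination of the F_j. *)
Lemma residue_idealI (p : sympoly R k) : p \in idealI n a -> residue (sympoly_val p * arho) = 0.
Proof.
move=> /idealIP[q ->]; rewrite sympoly_val_sum mulr_suml residue_sum big1 // => i _.
pose r := \col_m sympoly_val (idealI_gen n a m).
have rE : vmx R k *m r = \col_j ('X_j ^+ n - lowpart j).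
  apply/matrixP => j z; rewrite !mxE.
  rewrite (exp_var_vpolyD1 R j n) /lowpart -sumrB; apply: eq_bigr => m _.
  rewrite !mxE -[sympoly_val _]/(mcompl R k (n - k + m.+1) - a m *: 1) mulrBr -scalerAr mulr1.
  congr (_ * _ - _); rewrite /hs /hshift.
  have -> : (k.-1 <= n + m)%N by lia.
  by rewrite hcomplT; congr mcompl; have := ltn_ord m; lia.
have : \adj (vmx R k) *m (vmx R k *m r) = arho *: r.
  by rewrite mulmxA mul_adj_mx det_vmx mul_scalar_mx.
rewrite rE => /matrixP /(_ i 0); rewrite !mxE mulrC => rho_r.
rewrite sympoly_valM -mulrA -[in X in _ * (X * _)]/(sympoly_val _) -rho_r mulr_sumr residue_sum.
by rewrite big1 // => j _; rewrite !mxE mulrA residue_relation.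
Qed.

(* If m != 0 contributes, compare the exponents of the variables x_i with m_i > 0: they are distinct
   before and after, and [lowpart j] is squarefree and free of x_j, so it cannot compensate for the
   division by x_j^n. *)
Lemma residue_small q : (forall t, t \in msupp q ->
    injective t /\ forall i, (t i + k < 2 * n)%N) ->
  residue q = q@_tau.
Proof.
move=> q_small; pose b := (msize q).+1; rewrite (@residueE b) ?/b //.
rewrite (bigD1 bm0) //= big1 ?addr0 => [|m m0].
  rewrite /residue_term /lowprod big1 ?mulr1 => [|j _]; last by rewrite mnm0E.
  by congr (_@__); apply/mnmP => i; rewrite mnmDE mulmnE mnm0E mul0n addn0.
apply/eqP; rewrite mcoeff_eq0; apply/negP.
move=> /msuppM_le /allpairsP[[t v] [/= tq vm]] tvE.
pose A := [set i | (m : 'X_{1..k}) i != 0%N]; pose f (w : 'X_{1..k}) := (\sum_(i in A) w i)%N.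
have f0 : f 0%MM = 0%N by rewrite /f big1 // => i _; rewrite mnm0E.
have fD w w' : f (w + w')%MM = (f w + f w')%N.
  by rewrite /f -big_split; apply: eq_bigr => i _; rewrite mnmDE.
have fm : f m = mdeg m.
  rewrite mdegE /f big_mkcond /=; apply: eq_bigr => i _; rewrite inE.
  by case: eqP => // ->.
have le_Am : (#|A| <= mdeg m)%N.
  rewrite -fm -sum1_card; apply: leq_sum => i; rewrite inE lt0n; exact.
have A0 : (0 < #|A|)%N.
  rewrite card_gt0; apply: contraNneq m0 => A0; apply/eqP/val_inj/mnmP => i /=.
  by rewrite mnm0E; apply/eqP; apply: contraT => mi; have := in_set0 i; rewrite -A0 inE mi.
have fv : (f v <= mdeg m * #|A|.-1)%N.
  rewrite mdegE big_distrl /=; apply: (supp_le_lowprod f0 fD _ vm) => j l mj w.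
  move=> /msupp_coef_vpolyD1[_ wj w1]; have jA : j \in A by rewrite inE.
  rewrite /f (bigD1 j) //= wj add0n (cardD1 j) jA /= -sum1_card.
  rewrite [leqRHS](eq_bigl (fun i => (i \in A) && (i != j))); last first.
    by move=> i; rewrite !inE andbC.
  by apply: leq_sum => i _.
have [t_inj t_lt] := q_small t tq.
(* With c = |A|, distinct exponents t_i <= 2n - k - 1 give f t <= c (2n - k - 1) - c (c - 1) / 2.
   Likewise, distinct tau_i >= n - k give f tau >= c (n - k) + c (c - 1) / 2. *)
have ft : (#|A| * #|A|.-1 <= 2 * \sum_(i in A) (2 * n - k.+1 - t i))%N.
  apply: sum_inj_nat => i j _ _ tij; apply/t_inj.
  by have := t_lt i; have := t_lt j; lia.
have ft' : (f t + \sum_(i in A) (2 * n - k.+1 - t i) = #|A| * (2 * n - k.+1))%N.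
  rewrite /f -big_split -sum_nat_const; apply: eq_bigr => i _ /=.
  by have := t_lt i; lia.
have ftau : (#|A| * #|A|.-1 <= 2 * \sum_(i in A) (tau i - (n - k)))%N.
  apply: sum_inj_nat => i j _ _; rewrite !mnmE => ij; apply: val_inj => /=.
  by have := ltn_ord i; have := ltn_ord j; lia.
have ftau' : (f tau = \sum_(i in A) (tau i - (n - k)) + #|A| * (n - k))%N.
  rewrite /f -sum_nat_const -big_split; apply: eq_bigr => i _ /=; rewrite mnmE.
  by have := ltn_ord i; lia.
have Ak : (#|A| <= k)%N by have := max_card A; rewrite card_ord.
(* The bounds combine to |m| (n - c + 1) <= c (n - c), which is impossible as |m| >= c > 0 and c <=
   n. *)
have := congr1 f tvE; rewrite !fD (_ : f (m *+ n)%MM = mdeg m * n)%N; last first.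
  by rewrite -fm /f big_distrl; apply: eq_bigr => i _; rewrite mulmnE.
move: (\sum_(i in A) _)%N (\sum_(i in A) _)%N ft ft' ftau ftau' => S1 S2.
move: (f t) (f v) (f tau) (mdeg m) #|A| le_Am A0 fv Ak => T V U M [|c] //= le_cM _.
move: le_kn => /subnK <-; move: (n - k)%N => x; rewrite addnK => leV lt_ck.
have -> : (2 * (x + k) - k.+1 = 2 * x + k.-1)%N by lia.
case: k lt_ck => [|l] // lt_cl; nia.
Qed.

End Residue.

(** * Dual bases and the structure constants *)

Section Duality.
Variables (R : comNzRingType) (k n : nat) (a : 'I_k -> R).
Hypothesis (le_kn : (k <= n)%N).
Implicit Types (la mu nu : boxpart k n) (t u : 'X_{1..k}).

Local Notation arho := (alternant R (@rho k)).

Lemma boxpart_complK : involutive (@boxpart_compl k n).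
Proof.
by move=> la; apply/val_inj/ffunP => i; rewrite !ffunE /= !rev_ordK.
Qed.

Definition shifted la i := (parts la i + rho i)%N.

Lemma shifted_dec la (i j : 'I_k) : (i < j)%N -> (shifted la j < shifted la i)%N.
Proof.
move=> lt_ij; rewrite /shifted /parts /rho.
by have := boxpart_nonincr la (ltnW lt_ij); have := ltn_ord j; lia.
Qed.

Lemma shifted_inj la mu : shifted la =1 shifted mu -> la = mu.
Proof.
move=> eq_la; apply/val_inj/ffunP => i; apply: val_inj.
by have := eq_la i; rewrite /shifted => /addIn.
Qed.

Lemma shifted_compl la i : (shifted (boxpart_compl la) (rev_ord i) + shifted la i = n.-1)%N.
Proof.
rewrite /shifted /parts /rho /= ffunE rev_ordK /=.
by have := ltn_ord (la i); have := ltn_ord i; lia.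
Qed.

Lemma incr_perm_id (s : 'S_k) :
  (forall i j : 'I_k, (i < j)%N -> (s i < s j)%N) -> s = 1%g.
Proof.
move=> s_inc; apply/perm.permP => i; rewrite perm1; apply: val_inj => /=.
have s_dec (j l : 'I_k) : (j < l)%N -> (k - s l < k - s j)%N.
  by move=> /s_inc; have := ltn_ord (s l); lia.
have lt_0 : (0 < k)%N by have := ltn_ord i; lia.
have lt_k : (k.-1 < k)%N by lia.
have := @decreasing_gap _ _ s_dec (Ordinal lt_0) i (leq0n _).
have := @decreasing_gap _ _ s_dec i (Ordinal lt_k) => /=.
have := ltn_ord i; have := ltn_ord (s i); have := ltn_ord (s (Ordinal lt_k)).
by have := ltn_ord (s (Ordinal lt_0)); lia.
Qed.

(** Both exponent vectors decrease strictly, so only the identity permutation can match them. *)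
Lemma mcoeff_alternant_shifted la nu :
  (alternant R (shifted la))@_[multinom shifted nu i | i < k] = (la == nu)%:R.
Proof.
rewrite alternantE raddf_sum /= (bigD1 1%g) //= big1 ?addr0 => [|s s1].
  rewrite odd_perm1 expr0 scale1r mcoeffX; congr (_%:R); congr nat_of_bool.
  apply/eqP/eqP => [/mnmP eq_la|->].
    by apply: shifted_inj => i; have := eq_la i; rewrite !mnmE perm1.
  by apply/mnmP => i; rewrite !mnmE perm1.
rewrite mcoeffZ mcoeffX; case: eqP => [/mnmP eq_s|_]; last by rewrite mulr0.
case/eqP: s1; apply: incr_perm_id => i j lt_ij.
have := shifted_dec nu lt_ij; rewrite -[shifted nu i]mnmE -[shifted nu j]mnmE.
rewrite -!eq_s !mnmE; case: (ltngtP (s i) (s j)) => // [/(shifted_dec la)|/val_inj ->].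
  by case: ltngtP.
by rewrite ltnn.
Qed.

(** Since the shifted exponents of mu and, reversed, of its complement add up to n - 1, the
    substitution of rv s^-1 rv for s turns this expansion into that of the coefficient of x^(mu^vee
    + rho) in s_lambda a_rho = a_(lambda+rho). *)
Lemma mcoeff_tau_schur la mu :
  (sympoly_val (schur R (parts la)) * alternant R (shifted mu))@_(tau k n)
  = (la == boxpart_compl mu)%:R.
Proof.
rewrite -mcoeff_alternant_shifted -(schurP R (parts la)) !mcoeffM_alternant.
pose rv : 'S_k := perm (@rev_ord_inj k).
have rvE i : rv i = rev_ord i by rewrite permE.
have h_inj : injective (fun s : 'S_k => rv * s^-1 * rv)%g.
  by move=> s s' /mulIg /mulgI /invg_inj.
rewrite [RHS](reindex_inj h_inj); apply: eq_bigr => s _ /=.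
rewrite !odd_permM odd_permV addbAC addbb /=.
have entry i : (tau k n i - shifted mu (s i) =
    shifted (boxpart_compl mu) (rev_ord (s i)) - rho (rev_ord i))%N /\
    (shifted mu (s i) <= tau k n i)%N =
    (rho (rev_ord i) <= shifted (boxpart_compl mu) (rev_ord (s i)))%N.
  have := shifted_compl mu (s i); rewrite mnmE /rho /=.
  by have := ltn_ord i; move: (shifted _ _) (shifted _ _) => x y; split; lia.
have le_eq : (mnmp (shifted mu) s <= tau k n)%MM =
    (mnmp (@rho k) (rv * s^-1 * rv) <= [multinom shifted (boxpart_compl mu) i | i < k])%MM.
  apply/mnm_lepP/mnm_lepP => le_s i.
    rewrite !mnmE !permM !rvE.
    have := le_s (s^-1 (rev_ord i))%g; rewrite [in X in X -> _]mnmE (entry _).2 permKV.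
    by rewrite rev_ordK.
  rewrite [leqLHS]mnmE (entry _).2; have := le_s (rev_ord (s i)).
  by rewrite !mnmE !permM !rvE rev_ordK permK.
rewrite le_eq; congr (_ * _); case: ifP => // _.
rewrite -(msym_coeff _ (rv * s^-1)%g (sympoly_valP _)); congr (_@__).
apply/mnmP => i; rewrite mnmE !mnmBE [X in (_ - X)%N]mnmE (entry _).1 !mnmE.
by rewrite !permM !rvE permKV rev_ordK.
Qed.

(** The product is a combination of alternants with exponents at most (n - k) + (n - 1), so
    [residue_small] applies and the a_i drop out. *)
Lemma residue_schurM la mu :
  residue n a (sympoly_val (schur R (parts la) * schur R (parts mu)) * arho)
  = (la == boxpart_compl mu)%:R.
Proof.
rewrite sympoly_valM -mulrA schurP -mcoeff_tau_schur residue_small // => t.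
rewrite sym_mul_alternant ?sympoly_valP // => /msupp_sum_le /flattenP[r /mapP[u]].
rewrite mem_filter => /andP[_ up] -> /msuppZ_le tu.
pose e i := (u i + shifted mu i)%N; rewrite -/e in tu.
have [/injectiveP e_inj|/injectiveP e_ninj] := boolP (injectiveb e); last first.
  by move: tu; rewrite alternant_jacobi_trudi (jacobi_trudi_eq0 _ e_ninj) mul0r msupp0.
have [s ->] := msupp_alternant tu; split=> [i j|i]; first by rewrite !mnmE => /e_inj /perm_inj.
rewrite mnmE /e; have ub : (u (s i) <= n - k)%N.
  by apply: msupp_schur_le up => j; rewrite -ltnS /parts ltn_ord.
have : (shifted mu (s i) < n)%N.
  by rewrite /shifted /parts /rho; have := ltn_ord (mu (s i)); have := ltn_ord (s i); lia.
lia.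
Qed.

Definition residue_quot (x : symquot n a) : R := residue n a (sympoly_val (repr x) * arho).

Lemma residue_quotE p : residue_quot (symproj n a p) = residue n a (sympoly_val p * arho).
Proof.
have : repr (symproj n a p) - p \in idealI n a by rewrite -symproj_eq reprK_symquot.
move=> /(residue_idealI le_kn).
rewrite -[sympoly_val (_ - _)]/(sympoly_val _ - sympoly_val p) mulrBl addrC -scaleN1r.
by rewrite residueP // mulN1r addrC => /eqP; rewrite subr_eq0 => /eqP.
Qed.

Lemma residue_quotP c x y : residue_quot (c *: x + y) = c * residue_quot x + residue_quot y.
Proof.
rewrite -(reprK_symquot x) -(reprK_symquot y) -symprojZ -symprojD !residue_quotE.
by rewrite -residueP // scalerAl -mulrDl.
Qed.

Lemma symprojM p q : symproj n a (p * q) = symproj n a p * symproj n a q.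
Proof. exact: esym (symproj_mul n a p q). Qed.

Definition dual_form mu (x : symquot n a) : R^o :=
  residue_quot (x * schurbar a (boxpart_compl mu)).

Lemma dual_form_is_linear mu : linear (dual_form mu).
Proof. by move=> c x y; rewrite /dual_form mulrDl -symquot_scaleAl residue_quotP. Qed.

HB.instance Definition _ mu :=
  GRing.isLinear.Build R (symquot n a) R^o _ (dual_form mu) (dual_form_is_linear mu).

Lemma dual_form_schurbar mu la : dual_form mu (schurbar a la) = (la == mu)%:R.
Proof.
by rewrite /dual_form -symprojM residue_quotE residue_schurM boxpart_complK.
Qed.

(** [dual_form mu] witnesses the property by which [coeff] is chosen, and the spanning Schur classes
    force any two such forms to agree. *)
Lemma coeffE mu : coeff a mu =1 dual_form mu.
Proof.
have coeffP := epsilon_spec (inhabits (\0 : {linear symquot n a -> R^o}))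
  (fun f : {linear symquot n a -> R^o} => forall la, f (schurbar a la) = (la == mu)%:R)
  (ex_intro _ (dual_form mu : {linear _ -> _}) (dual_form_schurbar mu)).
move=> x; rewrite -(reprK_symquot x).
have [c ->] := symproj_in_span a le_kn (repr x).
rewrite !linear_sum; apply: eq_bigr => la _; rewrite !linearZ /= dual_form_schurbar.
by rewrite coeffP.
Qed.

Lemma gcoeffE al be ga :
  gcoeff a al be ga = residue_quot (schurbar a al * schurbar a be * schurbar a ga).
Proof. by rewrite /gcoeff coeffE /dual_form boxpart_complK. Qed.

(** The complement of omega is the empty partition, so the coefficient at omega is [residue_quot]
    itself. *)
Lemma schurbar_compl_omega : schurbar a (boxpart_compl (boxpart_omega k n)) = 1.
Proof.
rewrite /schurbar schurE (@eq_jacobi_trudi _ _ _ (@rho k)) ?jacobi_trudi_rho //.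
by move=> i; rewrite /parts /= !ffunE /= subnn.
Qed.

End Duality.

Theorem corollary6p24 (R : comNzRingType) (k n : nat) (hkn : (k <= n)%N)
    (a : 'I_k -> R) (alpha beta gamma : boxpart k n) :
  let g := gcoeff a in
  g alpha beta gamma = g alpha gamma beta /\
  g alpha gamma beta = g beta alpha gamma /\
  g beta alpha gamma = g beta gamma alpha /\
  g beta gamma alpha = g gamma alpha beta /\
  g gamma alpha beta = g gamma beta alpha /\
  g gamma beta alpha =
    coeff a (boxpart_omega k n)
      (symproj n a
        (schur R (parts alpha) * schur R (parts beta) * schur R (parts gamma))).
Proof.
move=> g; have gE al be ga : g al be ga = _ := gcoeffE a hkn al be ga.
have omegaE p : coeff a (boxpart_omega k n) (symproj n a p) = residue_quot (symproj n a p).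
  by rewrite coeffE // /dual_form schurbar_compl_omega mulr1.
rewrite !gE omegaE.
rewrite !symprojM -!/(schurbar a _).
move: (schurbar a alpha) (schurbar a beta) (schurbar a gamma) => x y z.
by rewrite (mulrC y x) (mulrC z x) (mulrC z y) (mulrAC x z) (mulrC (y * z)) mulrA; do !split.
Qed.
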